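(* Let $m\ge1$ and let $a_1,\dots,a_m\ge2$ be integers. Then the adjacent cycle chain $C_{a_1}+C_{a_2}+\cdots+C_{a_m}$ is $e$-positive.
   Context: $C_a$ is the cycle graph on $\{1,\dots,a\}$ with edges $(1,2),(2,3),\dots,(a-1,a),(a,1)$ (for $a=2$ this is a single edge). If $G_1,G_2$ are graphs with vertices labeled $1,\dots,k_1$ and $1,\dots,k_2$, then $G_1+G_2$ is the graph on $\{1,\dots,k_1+k_2-1\}$ with edge set $E(G_1)\cup\{(i+k_1-1,j+k_1-1):(i,j)\in E(G_2)\}$, i.e. the last vertex of $G_1$ is identified with the first vertex of $G_2$; this operation is associative. An adjacent cycle chain is a graph of the form $C_{a_1}+\cdots+C_{a_m}$ with $m\ge1$ and all $a_i\ge2$. The chromatic symmetric function of a graph $G$ with $n$ vertices is $X_G(\boldsymbol{x})=\sum_\kappa\prod_{v\in V(G)}x_{\kappa(v)}$, summed over proper colorings $\kappa:V(G)\to\mathbb{N}$, in infinitely many variables $\boldsymbol{x}=(x_i)_{i\in\mathbb{N}}$. $e_k=\sum_{i_1<\cdots<i_k}x_{i_1}\cdots x_{i_k}$ and $e_\lambda=\prod_i e_{\lambda_i}$ for a partition $\lambda$. $X_G$ is uniquely a linear combination $\sum_\lambda c_\lambda e_\lambda$ over partitions $\lambda$ of $n$, and $G$ is $e$-positive if all $c_\lambda\ge0$. *)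

(* Defs.v *)
From HB Require Import structures.
From mathcomp Require Import all_boot all_order all_algebra finmap.
From mathcomp Require Import boolp classical_sets cardinality fsbigop.
From mathcomp.multinomials Require Import monalg.

Set Implicit Arguments.
Unset Strict Implicit.
Unset Printing Implicit Defensive.

Import GRing.Theory.

Local Open Scope classical_set_scope.
Local Open Scope ring_scope.

(** * Labelled simple graphs

    The vertices of a graph of order k are 0, ..., k - 1 instead of
    1, ..., k; all vertex labels below are shifted accordingly. *)

Record sgraph := SGraph {
  nvert : nat;
  edge : rel 'I_nvert;
  edge_sym : symmetric edge;
  edge_irr : irreflexive edge }.

Section Cycle.
Variable a : nat.

(* The guard i != j only matters for a = 1, where it excludes a loop. *)
Definition cycle_edge : rel 'I_a := fun i j =>
  (i != j) && ((j == i.+1 %% a :> nat)%N || (i == j.+1 %% a :> nat)%N).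

Lemma cycle_edge_sym : symmetric cycle_edge.
Proof. by move=> i j; rewrite /cycle_edge eq_sym orbC. Qed.

Lemma cycle_edge_irr : irreflexive cycle_edge.
Proof. by move=> i; rewrite /cycle_edge eqxx. Qed.

Definition cycle_graph := SGraph cycle_edge_sym cycle_edge_irr.
End Cycle.

Section Gluing.
Variables G1 G2 : sgraph.

Definition glue_order : nat := (nvert G1 + nvert G2 - 1)%N.

(* Vertex i of G1 keeps its label and vertex i of G2 becomes
   i + (nvert G1 - 1), so that vertex 0 of G2 is the last vertex of G1. *)
Definition glue_edge : rel 'I_glue_order := fun u v =>
  [exists i, exists j, [&& @edge G1 i j, u == i :> nat & v == j :> nat]] ||
  [exists i, exists j, [&& @edge G2 i j,
     u == (i + (nvert G1 - 1))%N :> nat & v == (j + (nvert G1 - 1))%N :> nat]].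

Lemma glue_edge_sym : symmetric glue_edge.
Proof.
have sub u v : glue_edge u v -> glue_edge v u.
  case/orP=> /existsP[i /existsP[j /and3P[eij ui vj]]]; apply/orP; [left|right];
  by apply/existsP; exists j; apply/existsP; exists i; rewrite edge_sym eij vj ui.
by move=> u v; apply/idP/idP; apply: sub.
Qed.

Lemma glue_edge_irr : irreflexive glue_edge.
Proof.
move=> u; apply/negP.
case/orP=> /existsP[i /existsP[j /and3P[eij /eqP ui /eqP uj]]].
  by move: eij; rewrite (_ : i = j) ?edge_irr //; apply: val_inj; rewrite /= -ui.
move: eij; rewrite (_ : i = j) ?edge_irr //; apply: val_inj => /=.
by apply/eqP; rewrite -(eqn_add2r (nvert G1 - 1)) -ui -uj.
Qed.

Definition glue := SGraph glue_edge_sym glue_edge_irr.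
End Gluing.

(* C_{a_1} + ... + C_{a_m}; the value on the empty sequence is irrelevant. *)
Definition adjacent_cycle_chain (s : seq nat) : sgraph :=
  if s is a :: s' then foldl glue (cycle_graph a) [seq cycle_graph b | b <- s']
  else cycle_graph 1.

(** * Formal power series in the variables (x_i), i : nat

    {cmonom nat} is the type of monomials in these variables, with x_i being
    ucm i; a series is given by its coefficients. *)

Definition fps := {cmonom nat} -> int.

(* The formal sum of the monomials w t over t in A.  In the uses below each
   monomial is w t for finitely many t in A only. *)
Definition fps_msum (T : choiceType) (A : set T) (w : T -> {cmonom nat}) : fps :=
  fun m => \sum_(t \in A) ((w t == m)%:R : int).

Definition fps_one : fps := fun m => (m == mone)%:R : int.

(* The index set is finite: a monomial has finitely many divisors. *)
Definition fps_mul (f g : fps) : fps := fun m =>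
  \sum_(p \in [set p : {cmonom nat} * {cmonom nat} | mmul p.1 p.2 = m])
     f p.1 * g p.2.

Definition elementary (k : nat) : fps :=
  fps_msum [set S : {fset nat} | #|` S| = k]
           (fun S => \big[mmul/mone]_(i <- S) ucm i).

Definition elementary_part (l : seq nat) : fps :=
  \big[fps_mul/fps_one]_(k <- l) elementary k.

Definition is_partition_of (n : nat) (l : seq nat) : Prop :=
  [/\ sorted geq l, all (leq 1) l & sumn l = n].

(** * Chromatic symmetric functions and e-positivity *)

Definition proper_coloring (G : sgraph) (kappa : {ffun 'I_(nvert G) -> nat}) :=
  forall u v, edge u v -> kappa u <> kappa v.

Definition chromatic_sym (G : sgraph) : fps :=
  fps_msum (@proper_coloring G) (fun kappa => \big[mmul/mone]_v ucm (kappa v)).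

(* c gives the coefficients of f, homogeneous of degree n, in the elementary
   basis; its values outside the (finite) set of partitions of n play no role. *)
Definition e_expansion (n : nat) (f : fps) (c : seq nat -> int) : Prop :=
  forall m, f m = \sum_(l \in is_partition_of n) c l * elementary_part l m.

(* The e_lambda form a Z-basis of the symmetric functions with integer
   coefficients, so the expansion exists, is unique and has integer
   coefficients: it does not matter whether one asks for some or for all
   expansions, nor whether one allows rational coefficients. *)
Definition e_positive (G : sgraph) : Prop :=
  exists2 c : seq nat -> int,
    e_expansion (nvert G) (chromatic_sym G) c &
    forall l, is_partition_of (nvert G) l -> 0 <= c l.

(* Main.v *)
Require Import Defs.
From mathcomp Require Import boolp classical_sets fsbigop finmap.
From mathcomp.multinomials Require Import monalg.
From mathcomp Require Import all_boot all_order all_algebra.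
From mathcomp Require Import ring zify.

(* Work with a rooted graph G and record the colour j of the root, the sum of
   the weights of the proper colourings with that root colour being F_G(j).
   The series h_k(j) = x_j e_{k-1}(x without x_j) sum over j to k e_k, and
   attaching a cycle with n + 1 vertices is the linear operator
     (Phi_n F)(j) = sum_{i <> j} F(i) w_n(i, j)
   where w_n(i, j) enumerates the proper colourings of a path from i to j.  For
   i <> j the generating function of w_n(i, j) over n is
     z x_j prod_{l <> i, j} (1 + z x_l) / (E(z) - z E'(z)),
   whence the recurrence
     Phi_n F = sum_{r >= 2} (r - 1) e_r Phi_{n-r} F + M_n F,
   and an explicit computation of M_n h_k shows that it is a combination of the
   e_a h_b with nonnegative coefficients.  So Phi_n preserves the cone of
   nonnegative combinations of products of some h_k and e_l's; the single vertex
   has F = h_1, and summing over the root colour gives e-positivity.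
   A coefficient of a power series in infinitely many variables is read off in
   finitely many of them, provided that the combination of e_l's is the same
   for every number of variables. *)

Set Implicit Arguments.
Unset Strict Implicit.
Unset Printing Implicit Defensive.

Import GRing.Theory.

Local Open Scope ring_scope.

(** * Walks and rooted elementary symmetric polynomials *)

Section RootedElementary.
Variables (R : comNzRingType) (I : finType) (x : I -> R).

Definition esp (A : {set I}) (k : nat) : R :=
  \sum_(B : {set I} | (B \subset A) && (#|B| == k)) \prod_(b in B) x b.

(** For [j] in [A], the part of [esp A k] coming from the sets that contain [j]. *)
Definition rooted_esp (A : {set I}) (k : nat) (j : I) : R :=
  if k is k'.+1 then x j * esp (A :\ j) k' else 0.

Arguments rooted_esp : simpl never.

Lemma esp0 A : esp A 0 = 1.
Proof.
rewrite /esp (big_pred1 set0) ?big_set0 // => B /=.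
by rewrite cards_eq0 andbC; case: eqP => // ->; rewrite sub0set.
Qed.

Lemma esp_root (A : {set I}) k j : j \in A -> esp A k = esp (A :\ j) k + rooted_esp A k j.
Proof.
case: k => [|k] jA; first by rewrite !esp0 addr0.
rewrite /esp (bigID (fun B : {set I} => j \notin B)) /=; congr (_ + _).
  apply: eq_bigl => B; rewrite subsetD1 -!andbA; congr (_ && _); exact: andbC.
rewrite /rooted_esp big_distrr /= (reindex_onto (fun B => j |: B) (fun B => B :\ j)) /=; last first.
  by move=> B /andP[_ /negPn jB]; rewrite setD1K.
apply: eq_big => B.
  rewrite subUset sub1set jA /= setU11 /= andbT subsetD1.
  have [jB|jB] := boolP (j \in B); last by rewrite setU1K // cardsU1 jB eqxx !andbT.
  rewrite !andbF /=; apply/negP => /andP[_ /eqP].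
  by move/setP/(_ j); rewrite !inE eqxx jB.
case/andP=> _ /eqP BE; have jB: j \notin B by rewrite -BE !inE eqxx.
by rewrite big_setU1.
Qed.

Lemma rooted_espS (A : {set I}) k j : j \in A ->
  rooted_esp A k.+1 j = x j * (esp A k - rooted_esp A k j).
Proof. by move=> jA; rewrite [esp A k](esp_root _ jA) addrK. Qed.

(** Double counting: each [k]-subset of [A] arises once for each of its [k] elements. *)
Lemma sum_rooted_esp (A : {set I}) k : \sum_(j in A) rooted_esp A k j = esp A k *+ k.
Proof.
case: k => [|k]; first by rewrite big1 // mulr0n.
have -> : \sum_(j in A) rooted_esp A k.+1 j =
    \sum_(j in A) \sum_(B : {set I} | (B \subset A) && (#|B| == k.+1) && (j \in B))
      \prod_(b in B) x b.
  apply: eq_bigr => j jA.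
  have:= esp_root k.+1 jA.
  rewrite {1}/esp (bigID (fun B : {set I} => j \notin B)) /=.
  rewrite [X in X + _ = _](_ : _ = esp (A :\ j) k.+1).
    by move/addrI <-; apply: eq_bigl => B; rewrite negbK.
  by apply: eq_bigl => B; rewrite subsetD1 -!andbA; congr (_ && _); exact: andbC.
rewrite (exchange_big_dep (fun B : {set I} => (B \subset A) && (#|B| == k.+1))) /=; last first.
  by move=> j B _ /andP[].
rewrite /esp -sumrMnl; apply: eq_bigr => B /andP[BA /eqP Bk].
rewrite -[in RHS]Bk sumr_const; congr (_ *+ _); apply: eq_card => j.
by rewrite unfold_in BA Bk eqxx /=; apply: andb_idl => /(subsetP BA).
Qed.

Lemma rooted_esp_root (A : {set I}) k i j : i \in A -> i != j ->
  rooted_esp A k.+1 j = rooted_esp (A :\ i) k.+1 j + x i * rooted_esp (A :\ i) k j.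
Proof.
move=> iA ij; have iAj : i \in A :\ j by rewrite !inE ij.
rewrite /rooted_esp (esp_root _ iAj) setDDl setUC -setDDl mulrDr; congr (_ + _).
by case: k => [|k]; rewrite /rooted_esp ?mulr0 // setDDl setUC -setDDl mulrCA.
Qed.

Lemma sum_rooted_espD1 j k :
  \sum_(i | i != j) x i * rooted_esp ([set: I] :\ i) k j = rooted_esp setT k.+1 j *+ k.
Proof.
case: k => [|k]; first by rewrite big1 // => i _; rewrite mulr0.
rewrite /rooted_esp -mulrnAr -sum_rooted_esp big_distrr /=; apply: eq_big => [i|i _]; first by rewrite !inE andbT.
by rewrite mulrCA setDDl setUC -setDDl.
Qed.

Local Notation e := (esp setT).
Local Notation h := (rooted_esp setT).

(** Iterate [h_k h_n = e_k h_n - e_(n-1) h_(k+1) + h_(k+1) h_(n-1)] down to [h_0 = 0]. *)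
Lemma rooted_espM k n j : h k j * h n j =
  \sum_(q < n) (e (k + q)%N * h (n - q)%N j - e (n - q.+1)%N * h (k + q.+1)%N j).
Proof.
elim: n k => [|n IHn] k; first by rewrite big_ord0 mulr0.
rewrite big_ord_recl.
rewrite (eq_bigr (fun q : 'I_n => e (k.+1 + q)%N * h (n - q)%N j -
    e (n - q.+1)%N * h (k.+1 + q.+1)%N j)); last first.
  by move=> q _; rewrite lift0 !addnS !addSn !subSS.
rewrite -IHn addn0 addn1 subn0 subn1 /= !rooted_espS ?in_setT //.
ring.
Qed.

(** The weight of the start [i] is left out: the graph to which the walk is attached already counts
    it. *)
Fixpoint walk (n : nat) (i j : I) : R :=
  if n is n'.+1 then x j * \sum_(l | l != j) walk n' i l else (i == j)%:R.

(* The coefficients of E(z) - z E'(z), where E(z) = \sum_r e_r z^r. *)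
Definition ecoef (r : nat) : R := (1 - r%:R) * e r.

(** The coefficient of [z^n] in [E - z E'] times the generating function of walks. The induction
    removes the last step and sums over all [l != j], so it needs the diagonal case too. *)
Lemma walk_ecoef n i j :
  \sum_(r < n.+1) ecoef r * walk (n - r) i j =
  if i == j then (1 - n%:R) * esp ([set: I] :\ i) n
  else rooted_esp ([set: I] :\ i) n j.
Proof.
elim: n j => [|n IHn] j.
  by rewrite big_ord1 /ecoef !esp0 /rooted_esp /=; case: eqP => _ /=; ring.
rewrite big_ord_recr /= subnn /=.
rewrite (eq_bigr (fun r : 'I_n.+1 =>
    x j * \sum_(l | l != j) ecoef r * walk (n - r) i l)); last first.
  by move=> r _; rewrite subSn ?leq_ord //= mulrCA big_distrr.
rewrite -big_distrr exchange_big /=.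
under eq_bigr => l _ do rewrite IHn.
have sum_other : \sum_(l | l != i) rooted_esp ([set: I] :\ i) n l = esp ([set: I] :\ i) n *+ n.
  by rewrite -sum_rooted_esp; apply: eq_bigl => l; rewrite !inE andbT.
have [<-{j}|ij] := eqVneq i j.
  rewrite (eq_bigr (fun l => rooted_esp ([set: I] :\ i) n l)); last first.
    by move=> l; rewrite eq_sym => /negPf ->.
  by rewrite sum_other /ecoef (esp_root _ (in_setT i)) /rooted_esp mulr1; ring.
rewrite mulr0 addr0 (bigD1 i) //= eqxx.
rewrite (eq_bigr (fun l => rooted_esp ([set: I] :\ i) n l)); last first.
  by move=> l; rewrite andbC eq_sym => /andP[/negPf ->].
rewrite rooted_espS ?inE 1?eq_sym ?ij //.
move: sum_other; rewrite (bigD1 j) 1?eq_sym //=.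
rewrite (eq_bigl _ _ (fun l => andbC _ _)) => /(canRL (addKr _)) ->; ring.
Qed.

(* Attaching a cycle with [n.+1] vertices to a rooted graph along its first
   vertex, and moving the root to the last vertex of the cycle. *)
Definition cyc (n : nat) (F : I -> R) (j : I) : R :=
  \sum_(i | i != j) F i * walk n i j.

Definition cyc_rest (n : nat) (F : I -> R) (j : I) : R :=
  \sum_(i | i != j) F i * rooted_esp ([set: I] :\ i) n j.

(** [walk_ecoef] solved for its term [r = 0], where [ecoef 0 = 1]; since [- ecoef r.+1] is [r] times
    [e r.+1], no sign remains. *)
Lemma cyc_rec n F j :
  cyc n F j = \sum_(r < n) (e r.+1 * cyc (n - r.+1) F j) *+ r + cyc_rest n F j.
Proof.
have : \sum_(r < n.+1) ecoef r * cyc (n - r) F j = cyc_rest n F j.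
  under eq_bigr do rewrite /cyc big_distrr /=.
  rewrite exchange_big; apply: eq_bigr => i /negPf ij.
  under eq_bigr do rewrite mulrCA.
  by rewrite -big_distrr /= walk_ecoef ij.
rewrite big_ord_recl /= /ecoef esp0 subr0 !mul1r subn0 => <-.
rewrite addrCA -big_split big1 ?addr0 //= => r _; rewrite /bump add1n; ring.
Qed.

(** Sum over [i != j], using [h_(n+1)(I-i, j) = h_(n+1)(j) - x_i h_n(I-i, j)] and
    [x_i h_k(i) = x_i e_k - h_(k+1)(i)]. *)
Lemma cyc_rest_rec n k j :
  cyc_rest n.+1 (h k) j = cyc_rest n (h k.+1) j
    + h n.+1 j * (e k *+ k - h k j) - e k * h n.+1 j *+ n.
Proof.
have sum_other : \sum_(i | i != j) h k i = e k *+ k - h k j.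
  rewrite -sum_rooted_esp [in RHS](bigD1 j) ?inE //= addrAC subrr add0r.
  by apply: eq_bigl => i; rewrite inE.
rewrite -sum_other -mulrnAr -sum_rooted_espD1 !big_distrr /= -big_split /= -sumrB.
apply: eq_bigr => i ij; rewrite (rooted_esp_root n (in_setT i) ij) (rooted_espS k (in_setT i)); ring.
Qed.

(** [cyc_rest_rec] lowers [n] to [0], where [cyc_rest] vanishes, and [rooted_espM] expands the
    products of two [h]. The factors [k - n + q] may still be negative. *)
Lemma cyc_rest_rooted_esp n k j : cyc_rest n (h k) j =
  \sum_(q < n) ((k%:R - n%:R + q%:R) * (e (k + q)%N * h (n - q)%N j)
               + q.+1%:R * (e (n - q.+1)%N * h (k + q.+1)%N j)).
Proof.
elim: n k => [|n IHn] k.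
  by rewrite big_ord0 /cyc_rest big1 // => i _; rewrite mulr0.
rewrite cyc_rest_rec IHn.
have := rooted_espM k n.+1 j; rewrite big_ord_recl /= addn0 subn0 subn1 addn1 /=.
rewrite [X in _ -> _ = X]big_ord_recl /= addn0 subn0 subn1 addn1 /=.
under eq_bigr do rewrite /bump add1n subSS subSS.
under [in X in _ -> _ = X]eq_bigr do rewrite /bump add1n subSS subSS.
move=> hh; rewrite mulrBr [_ * h k j]mulrC hh.
(* Each summand for [n] and [k.+1] is a target summand plus one of [rooted_espM]; the latter cancel
   against [hh]. *)
rewrite (eq_bigr (fun q : 'I_n => 
   (((k%:R - n.+1%:R + q.+1%:R) * (e (k + q.+1)%N * h (n - q)%N j)
               + q.+2%:R * (e (n - q.+1)%N * h (k + q.+2)%N j)))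
   + (e (k + q.+1)%N * h (n - q)%N j - e (n - q.+1)%N * h (k + q.+2)%N j))); last first.
  by move=> q _; rewrite !addSn -!addnS; ring.
by rewrite big_split /=; ring.
Qed.

(* In [cyc_rest_rooted_esp] the terms with [q < n - k] cancel in pairs [q], [n - k - 1 - q]. *)
Lemma cyc_rest_rooted_esp_pos n k j : cyc_rest n (h k) j =
  \sum_(n - k <= q < n) ((e (k + q)%N * h (n - q)%N j) *+ (k + q - n)
               + (e (n - q.+1)%N * h (k + q.+1)%N j) *+ q.+1).
Proof.
rewrite cyc_rest_rooted_esp -(big_mkord xpredT (fun q => (k%:R - n%:R + q%:R) * (e (k + q)%N * h (n - q)%N j)
               + q.+1%:R * (e (n - q.+1)%N * h (k + q.+1)%N j))).
rewrite (big_cat_nat (n := (n - k)%N)) ?leq_subr //= big_split /=.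
rewrite [X in _ + X + _](_ : _ = - \sum_(0 <= q < n - k)
    (k%:R - n%:R + q%:R) * (e (k + q)%N * h (n - q)%N j)).
  rewrite subrr add0r; apply: eq_big_nat => q /andP[kq qn].
  rewrite mulr_natl; congr (_ + _).
  by rewrite -[RHS]mulr_natl natrB; [congr (_ * _); rewrite natrD; ring | lia].
rewrite -sumrN big_nat_rev /= add0n; apply: eq_big_nat => q /andP[_ qn].
have -> : ((n - k - q.+1).+1 = n - k - q)%N by lia.
have -> : (n - (n - k - q) = k + q)%N by lia.
have -> : (k + (n - k - q) = n - q)%N by lia.
rewrite -subnDA natrB; last by lia.
rewrite natrD; ring.
Qed.
End RootedElementary.
Arguments rooted_esp : simpl never.
Arguments walk : simpl never.

(** * The cone of nonnegative combinations *)

Section PositiveCone.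
Variables (R : comNzRingType) (x : nat -> R).

Local Notation ev N := (@esp R 'I_N (fun i : 'I_N => x i) [set: 'I_N]).
Local Notation hv N := (@rooted_esp R 'I_N (fun i : 'I_N => x i) [set: 'I_N]).
Local Notation cycv N := (@cyc R 'I_N (fun i : 'I_N => x i)).

Definition esp_prod N (l : seq nat) : R := \prod_(k <- l) ev N k.

(* The same combination has to work for every number N of variables. *)
Definition rooted_pos (d : nat) (F : forall N, 'I_N -> R) : Prop :=
  exists2 L : seq (nat * seq nat), {in L, forall p, (p.1 + sumn p.2)%N = d} &
    forall N j, F N j = \sum_(p <- L) esp_prod N p.2 * hv N p.1 j.

(** Repetitions in [L] encode natural coefficients; its members may be unsorted and contain [0]. *)
Definition esp_pos (d : nat) (f : nat -> R) : Prop :=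
  exists2 L : seq (seq nat), {in L, forall l, sumn l = d} &
    forall N, f N = \sum_(l <- L) esp_prod N l.

Lemma eq_rooted_pos d F G :
  (forall N j, F N j = G N j) -> rooted_pos d F -> rooted_pos d G.
Proof. by move=> FG [L Ld FE]; exists L => // N j; rewrite -FG. Qed.

Lemma rooted_pos0 d : rooted_pos d (fun N j => 0).
Proof. by exists [::] => // N j; rewrite big_nil. Qed.

Lemma rooted_posD d F G : rooted_pos d F -> rooted_pos d G ->
  rooted_pos d (fun N j => F N j + G N j).
Proof.
move=> [L Ld FE] [M Md GE]; exists (L ++ M) => [p|N j].
  by rewrite mem_cat => /orP[/Ld|/Md].
by rewrite big_cat FE GE.
Qed.

Lemma rooted_pos_sum (T : eqType) (r : seq T) (P : pred T) d (F : T -> forall N, 'I_N -> R) :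
  {in r, forall t, P t -> rooted_pos d (F t)} ->
  rooted_pos d (fun N j => \sum_(t <- r | P t) F t N j).
Proof.
elim: r => [|t r IHr] Fpos.
  by apply: eq_rooted_pos (rooted_pos0 d) => N j; rewrite big_nil.
have {}IHr : rooted_pos d (fun N j => \sum_(t <- r | P t) F t N j).
  by apply: IHr => u ur; apply: Fpos; rewrite inE ur orbT.
have [Pt|nPt] := boolP (P t).
  have Ft : rooted_pos d (F t) by apply: Fpos; rewrite ?mem_head.
  by apply: eq_rooted_pos (rooted_posD Ft IHr) => N j; rewrite big_cons Pt.
by apply: eq_rooted_pos IHr => N j; rewrite big_cons (negPf nPt).
Qed.

Lemma rooted_posMn d F n : rooted_pos d F -> rooted_pos d (fun N j => F N j *+ n).
Proof.
move=> Fpos; apply: (@eq_rooted_pos _ (fun N j => \sum_(t <- iota 0 n | predT t) F N j)).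
  by move=> N j; rewrite big_const_seq count_predT size_iota iter_addr_0.
exact: rooted_pos_sum.
Qed.

Lemma rooted_pos_prod d F l : rooted_pos d F ->
  rooted_pos (d + sumn l) (fun N j => esp_prod N l * F N j).
Proof.
move=> [L Ld FE]; exists [seq (p.1, l ++ p.2) | p <- L] => [_ /mapP[p pL ->]|N j] /=.
  by rewrite -(Ld _ pL) sumn_cat -addnA; congr (_ + _)%N; rewrite addnC.
rewrite FE big_map big_distrr; apply: eq_bigr => p _.
by rewrite /= mulrA /esp_prod big_cat.
Qed.

Lemma rooted_posM d F k : rooted_pos d F ->
  rooted_pos (d + k) (fun N j => ev N k * F N j).
Proof.
move/(rooted_pos_prod [:: k]); rewrite /= addn0; apply: eq_rooted_pos => N j.
by rewrite /esp_prod big_seq1.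
Qed.

Lemma rooted_pos_rooted_esp k : rooted_pos k (fun N => hv N k).
Proof.
exists [:: (k, [::])] => [p|N j]; first by rewrite inE => /eqP -> /=; rewrite addn0.
by rewrite big_seq1 /esp_prod big_nil mul1r.
Qed.

(** Strong induction on [n] through [cyc_rec]: the first sum involves shorter walks, the second is
    explicit, and all multiplicities are natural numbers. *)
Lemma rooted_pos_cyc_rooted_esp n k : rooted_pos (k + n) (fun N => cycv N n (hv N k)).
Proof.
elim/ltn_ind: n k => n IHn k.
apply: (@eq_rooted_pos _ (fun N j =>
  \sum_(r <- iota 0 n) (ev N r.+1 * cycv N (n - r.+1) (hv N k) j) *+ r
  + \sum_(q <- index_iota (n - k) n) ((ev N (k + q)%N * hv N (n - q)%N j) *+ (k + q - n)
               + (ev N (n - q.+1)%N * hv N (k + q.+1)%N j) *+ q.+1))).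
  by move=> N j; rewrite cyc_rec cyc_rest_rooted_esp_pos; congr (_ + _);
     rewrite -(big_mkord xpredT (fun r => (ev N r.+1 * cycv N (n - r.+1) (hv N k) j) *+ r))
       /index_iota subn0.
apply: rooted_posD; apply: rooted_pos_sum => q.
  rewrite mem_iota add0n => /andP[_ qn] _.
  apply: rooted_posMn; rewrite (_ : k + n = k + (n - q.+1) + q.+1)%N; last by lia.
  by apply: rooted_posM; apply: IHn; lia.
rewrite mem_index_iota => /andP[kq qn] _.
apply: rooted_posD; apply: rooted_posMn.
  rewrite (_ : k + n = n - q + (k + q))%N; last by lia.
  by apply: rooted_posM; apply: rooted_pos_rooted_esp.
rewrite (_ : k + n = k + q.+1 + (n - q.+1))%N; last by lia.
by apply: rooted_posM; apply: rooted_pos_rooted_esp.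
Qed.

(** [cyc] is linear in [F], and the factors [esp_prod N l] do not depend on the root colour. *)
Lemma rooted_pos_cyc n d F : rooted_pos d F ->
  rooted_pos (d + n) (fun N => cycv N n (F N)).
Proof.
move=> [L Ld FE].
apply: (@eq_rooted_pos _ (fun N j =>
   \sum_(p <- L | predT p) esp_prod N p.2 * cycv N n (hv N p.1) j)).
  move=> N j; rewrite /cyc; under [RHS]eq_bigr do rewrite FE big_distrl /=.
  rewrite [RHS]exchange_big; apply: eq_bigr => p _; rewrite big_distrr.
  by apply: eq_bigr => i _ /=; rewrite mulrA.
apply: rooted_pos_sum => p /Ld <- _; rewrite addnAC.
by apply: rooted_pos_prod; apply: rooted_pos_cyc_rooted_esp.
Qed.

Lemma esp_pos_sum_rooted d F : rooted_pos d F ->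
  esp_pos d (fun N => \sum_(j < N) F N j).
Proof.
(* Summing [h_k] over the root gives [k e_k], hence [k] copies of [k :: l] for a pair [(k, l)]. *)
move=> [L Ld FE]; exists (flatten [seq nseq p.1 (p.1 :: p.2) | p <- L]).
  move=> l /flatten_mapP[p pL]; rewrite mem_nseq => /andP[_ /eqP->] /=; exact: Ld.
move=> N; rewrite big_flatten big_map; under [LHS]eq_bigr do rewrite FE.
rewrite exchange_big; apply: eq_bigr => p _.
rewrite big_nseq iter_addr_0 /esp_prod big_cons mulrC -mulrnAr -big_distrr /=.
congr (_ * _); rewrite -[RHS](sum_rooted_esp (fun i : 'I_N => x i)).
by apply: eq_bigl => j; rewrite inE.
Qed.
End PositiveCone.

(** * Proper colourings as words *)

Section Words.
Variable I : finType.

Fixpoint words (n : nat) : seq (seq I) :=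
  if n is n'.+1 then [seq rcons w c | w <- words n', c <- enum I] else [:: [::]].

Lemma mem_words n w : (w \in words n) = (size w == n).
Proof.
elim: n w => [|n IHn] w; first by case: w.
case/lastP: w => [|w c].
  by apply/negP => /allpairsP[[u d] [_ _ /(congr1 size)]]; rewrite size_rcons.
rewrite size_rcons eqSS -IHn; apply/allpairsP/idP => [[[u d] [uw _]]|wn].
  by case/rcons_inj=> -> _.
by exists (w, c); rewrite mem_enum.
Qed.

Lemma words_uniq n : uniq (words n).
Proof.
elim: n => // n IHn; apply: allpairs_uniq => //; first exact: enum_uniq.
by move=> [u c] [v d] _ _ /= /rcons_inj[-> ->].
Qed.

(** Singles out the letter at position [m], the colour of the vertex shared by two glued graphs. *)
Lemma big_words_cat (R : nmodType) (m n : nat) (f : seq I -> R) :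
  \sum_(w <- words (m.+1 + n)) f w =
  \sum_(u <- words m) \sum_c \sum_(v <- words n) f (rcons u c ++ v).
Proof.
elim: n f => [|n IHn] f.
  rewrite addn0 big_allpairs_dep /=; apply: eq_bigr => u _; rewrite big_enum.
  by apply: eq_bigr => c _; rewrite big_seq1 cats0.
rewrite addnS big_allpairs_dep /= IHn; apply: eq_bigr => u _; apply: eq_bigr => c _.
rewrite big_allpairs_dep; apply: eq_bigr => v _; apply: eq_bigr => d _.
by rewrite rcons_cat.
Qed.
End Words.

(** [onth] needs no default letter, so empty alphabets such as ['I_0] are covered. *)
Definition proper_word (T : eqType) (G : sgraph) (w : seq T) : bool :=
  [forall u : 'I_(nvert G), forall v, edge u v ==> (onth w u != onth w v)].

(** The shared letter [c] ends one word and begins the other; each edge comes from one of the two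
    graphs. *)
Lemma proper_word_glue (T : eqType) (G1 G2 : sgraph) (u v : seq T) c :
  size (rcons u c) = nvert G1 -> size (c :: v) = nvert G2 ->
  proper_word (glue G1 G2) (rcons u c ++ v) =
  proper_word G1 (rcons u c) && proper_word G2 (c :: v).
Proof.
move=> su sv.
have Ecat1 i : (i < nvert G1)%N -> onth (rcons u c ++ v) i = onth (rcons u c) i.
  by move=> iG; rewrite !onthE map_cat nth_cat size_map su iG.
have Ecat2 i : onth (rcons u c ++ v) (i + (nvert G1 - 1))%N = onth (c :: v) i.
  have -> : (nvert G1 - 1 = size u)%N by rewrite -su size_rcons subn1.
  rewrite cat_rcons !onthE map_cat nth_cat size_map ltnNge leq_addl /=.
  by rewrite addnK.
have le1 (i : 'I_(nvert G1)) : (i < glue_order G1 G2)%N.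
  by rewrite /glue_order -sv; have := ltn_ord i; rewrite /=; lia.
have le2 (i : 'I_(nvert G2)) : (i + (nvert G1 - 1) < glue_order G1 G2)%N.
  by rewrite /glue_order -su size_rcons; have := ltn_ord i; lia.
apply/idP/andP => [/forallP ok|[/forallP ok1 /forallP ok2]].
  split; apply/forallP => i; apply/forallP => j; apply/implyP => ij.
    have /forallP/(_ (Ordinal (le1 j)))/implyP /= := ok (Ordinal (le1 i)).
    rewrite !Ecat1 //; apply; apply/orP; left.
    by apply/existsP; exists i; apply/existsP; exists j; rewrite ij !eqxx.
  have /forallP/(_ (Ordinal (le2 j)))/implyP /= := ok (Ordinal (le2 i)).
  rewrite !Ecat2; apply; apply/orP; right.
  by apply/existsP; exists i; apply/existsP; exists j; rewrite ij !eqxx.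
apply/forallP => a; apply/forallP => b; apply/implyP.
case/orP => /existsP[i /existsP[j /and3P[ij /eqP-> /eqP->]]].
  by rewrite !Ecat1 //; have /forallP/(_ j)/implyP := ok1 i; apply.
by rewrite !Ecat2; have /forallP/(_ j)/implyP := ok2 i; apply.
Qed.

(** A cycle is a path closed by an edge between its ends; for [n = 0] that edge is the path
    itself. *)
Lemma proper_word_cycle (T : eqType) n c (v : seq T) d : size v = n ->
  proper_word (cycle_graph n.+2) (c :: rcons v d) =
  path (fun a b => a != b) c (rcons v d) && (c != d).
Proof.
move=> sv; set w := c :: rcons v d.
have sw : size w = n.+2 by rewrite /= size_rcons sv.
have nthw i : (i < n.+2)%N -> onth w i = Some (nth c w i).
  by move=> iw; rewrite onthE (nth_map c) // sw.
have lastw : nth c w n.+1 = d.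
  by rewrite /w /= nth_rcons sv ltnn eqxx.
apply/idP/andP => [/forallP ok|[/(pathP c) okp cd]].
  split.
    apply/(pathP c) => i; rewrite size_rcons sv => iv.
    have i1 : (i < n.+2)%N by apply: ltnW.
    have E : cycle_edge (Ordinal i1) (Ordinal (iv : i.+1 < n.+2)%N).
      by rewrite /cycle_edge /= modn_small // eqxx -val_eqE /= neq_ltn ltnSn.
    have /forallP/(_ (Ordinal (iv : i.+1 < n.+2)%N))/implyP/(_ E) /= := ok (Ordinal i1).
    rewrite -[onth (rcons v d) i]/(onth w i.+1) !nthw // -[nth c (rcons v d) i]/(nth c w i.+1).
  have E : @cycle_edge n.+2 ord0 ord_max by rewrite /cycle_edge /= modnn eqxx orbT.
  have /forallP/(_ ord_max)/implyP/(_ E) := ok ord0.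
  by rewrite !nthw // (lastw : nth c w (@ord_max n.+1) = d).
have adj i : (i.+1 < n.+2)%N -> onth w i != onth w i.+1.
  move=> iw; rewrite !nthw //; last exact: ltnW.
  by have := okp i; rewrite size_rcons sv => /(_ iw); apply: contraNN => /eqP[->].
(* The only wrap-around is at [i = n.+1], the closing edge. *)
have step (i j : 'I_n.+2) : (j == i.+1 %% n.+2 :> nat)%N -> onth w i != onth w j.
  move=> /eqP ->; have [iw|iw] := ltnP i.+1 n.+2; first by rewrite modn_small // adj.
  have -> : i = n.+1 :> nat by have := ltn_ord i; lia.
  by rewrite modnn !nthw // lastw eq_sym; apply: contraNN cd => /eqP[->].
apply/forallP => i; apply/forallP => j; apply/implyP => /andP[_ /orP[|]] /step //.
by rewrite eq_sym.
Qed.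

(** * Chromatic sums with prescribed root colour *)

Section RootedChromatic.
Variables (R : comNzRingType) (I : finType) (x : I -> R).

Definition weight (w : seq I) : R := \prod_(c <- w) x c.

(** The root is the last vertex, where the next cycle is attached. *)
Definition rooted_chrom (G : sgraph) (j : I) : R :=
  \sum_(u <- words I (nvert G).-1 | proper_word G (rcons u j)) weight (rcons u j).

Lemma sum_rooted_chrom G : (0 < nvert G)%N ->
  \sum_j rooted_chrom G j = \sum_(w <- words I (nvert G) | proper_word G w) weight w.
Proof.
rewrite /rooted_chrom; case: (nvert G) (proper_word G) => // n ok _ /=.
under eq_bigr do rewrite big_mkcond.
rewrite [RHS]big_mkcond big_allpairs_dep exchange_big /=.
by apply: eq_bigr => u _; rewrite big_enum.
Qed.

(** [v] lists the [n] letters strictly between the ends of a walk of [n.+1] steps. *)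
Lemma walk_words n i j : walk x n.+1 i j =
  \sum_(v <- words I n | path (fun a b => a != b) i (rcons v j)) weight (rcons v j).
Proof.
elim: n j => [|n IHn] j.
  rewrite [RHS]big_mkcond big_seq1 /= andbT /weight big_seq1 /walk.
  have [<-|ij] := eqVneq i j.
    by rewrite big1 ?mulr0 // => l /negPf; rewrite eq_sym => ->.
  rewrite (bigD1 i) //= eqxx big1 ?addr0 ?mulr1 // => l /andP[_ /negPf].
  by rewrite eq_sym => ->.
rewrite [RHS]big_mkcond [RHS]big_allpairs_dep.
transitivity (x j * \sum_(l | l != j) walk x n.+1 i l) => //.
rewrite (eq_bigr _ (fun l _ => IHn l)).
under [X in _ * X = _]eq_bigr do rewrite big_mkcond.
rewrite exchange_big big_distrr; apply: eq_bigr => v _ /=.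
rewrite big_enum big_distrr big_mkcond; apply: eq_bigr => l _ /=.
rewrite [in RHS]rcons_path last_rcons; case: (l != j); last by rewrite andbF.
rewrite andbT; case: ifP => _; last by rewrite mulr0.
by rewrite /weight -[in RHS]cats1 big_cat big_seq1 mulrC.
Qed.

(** The vertices after the first form a walk from its colour to [j]; the closing edge is the
    condition [i != j] in [cyc]. *)
Lemma rooted_chrom_cycle n j : rooted_chrom (cycle_graph n.+2) j = cyc x n.+1 x j.
Proof.
rewrite /rooted_chrom big_mkcond -[(nvert _).-1]/(0.+1 + n)%N big_words_cat big_seq1 /cyc.
rewrite [RHS]big_mkcond; apply: eq_bigr => c _ /=.
rewrite big_seq (eq_bigr (fun v => if path (fun a b => a != b) c (rcons v j) then
   if c != j then x c * weight (rcons v j) else 0 else 0)); last first.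
  move=> v; rewrite mem_words => /eqP sv; rewrite proper_word_cycle //.
  by case: path; case: eqP => //= _; rewrite /weight big_cons.
rewrite -big_seq; case: (c != j); last by rewrite big1 // => v _; case: ifP.
by rewrite -big_mkcond walk_words big_distrr.
Qed.

(** Sort the colourings by the colour [c] of the shared vertex, whose weight is counted in [G]. *)
Lemma rooted_chrom_glue G n j : (0 < nvert G)%N ->
  rooted_chrom (glue G (cycle_graph n.+2)) j = cyc x n.+1 (rooted_chrom G) j.
Proof.
move=> G_gt0; rewrite /rooted_chrom big_mkcond /=.
have -> : (glue_order G (cycle_graph n.+2)).-1 = ((nvert G).-1.+1 + n)%N.
  by rewrite /glue_order /=; lia.
rewrite big_words_cat exchange_big /cyc [RHS]big_mkcond; apply: eq_bigr => c _ /=.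
rewrite -[RHS](_ : \sum_(u <- words I (nvert G).-1) (if c != j then 
   if proper_word G (rcons u c) then weight (rcons u c) * walk x n.+1 c j else 0 else 0) = _); last first.
  case: (c != j); last by rewrite big1.
  by rewrite -big_mkcond big_distrl.
rewrite big_seq [RHS]big_seq; apply: eq_bigr => u; rewrite mem_words => /eqP su.
rewrite big_seq (eq_bigr (fun v => if path (fun a b => a != b) c (rcons v j) then
   if (c != j) && proper_word G (rcons u c) then
     weight (rcons u c) * weight (rcons v j) else 0 else 0)); last first.
  move=> v; rewrite mem_words => /eqP sv.
  rewrite rcons_cat proper_word_glue /= ?size_rcons ?su ?prednK ?sv //.
  rewrite proper_word_cycle // andbC.
  by case: path; case: eqP; case: proper_word => //= _; rewrite /weight big_cat.
rewrite -big_seq -big_mkcond; case: (c != j) => /=; last by rewrite big1.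
case: proper_word; last by rewrite big1.
by rewrite walk_words big_distrr.
Qed.
End RootedChromatic.

(** * Adjacent cycle chains lie in the cone *)

Section Chains.
Variables (R : comNzRingType) (x : nat -> R).
Local Notation chrom G := (fun N => rooted_chrom (fun i : 'I_N => x i) G).

Lemma rooted_pos_cycle a : (2 <= a)%N ->
  rooted_pos x a (chrom (cycle_graph a)).
Proof.
case: a => [|[|n]] // _.
(* The cycle is attached to a single vertex, whose rooted series is [h_1]. *)
apply: (@eq_rooted_pos _ _ _ (fun N => cyc (fun i : 'I_N => x i) n.+1
    (rooted_esp (fun i : 'I_N => x i) [set: 'I_N] 1))) => [N j|].
  rewrite rooted_chrom_cycle; apply: eq_bigr => i _.
  by rewrite /rooted_esp esp0 mulr1.
by rewrite -add1n; apply/rooted_pos_cyc/rooted_pos_rooted_esp.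
Qed.

Lemma rooted_pos_glue G a : (2 <= a)%N -> (0 < nvert G)%N ->
  rooted_pos x (nvert G) (chrom G) ->
  rooted_pos x (nvert (glue G (cycle_graph a))) (chrom (glue G (cycle_graph a))).
Proof.
case: a => [|[|n]] // _ G0 Gpos.
rewrite [nvert (glue _ _)](_ : _ = nvert G + n.+1)%N; last by rewrite /= /glue_order /=; lia.
apply: eq_rooted_pos (rooted_pos_cyc n.+1 Gpos) => N j.
by rewrite rooted_chrom_glue.
Qed.

Lemma esp_pos_chain s : s != [::] -> all (leq 2) s ->
  let G := adjacent_cycle_chain s in
  esp_pos x (nvert G)
    (fun N => \sum_(w <- words 'I_N (nvert G) | proper_word G w) weight (fun i : 'I_N => x i) w).
Proof.
case: s => // a s _ /andP[a2 s2] G.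
suff [G0 Gpos] : (0 < nvert G)%N /\ rooted_pos x (nvert G) (chrom G).
  have [L Ld LE] := esp_pos_sum_rooted Gpos.
  by exists L => // N; rewrite -sum_rooted_chrom // LE.
rewrite {}/G /=.
have : rooted_pos x (nvert (cycle_graph a)) (chrom (cycle_graph a)).
  exact: rooted_pos_cycle.
have : (0 < nvert (cycle_graph a))%N by apply: leq_trans a2.
(* The graph built so far is generalised, following [foldl]. *)
elim: s (cycle_graph a) s2 => [|b s IHs] G //= /andP[b2 s2] G0 Gpos.
apply: IHs => //; last exact: rooted_pos_glue.
by rewrite /= /glue_order /=; lia.
Qed.
End Chains.

(** * Coefficients of power series *)

Local Notation series := {malg int[{cmonom nat}]}.

Definition var (i : nat) : series := << ucm i >>.

Definition bounded (N : nat) (m : {cmonom nat}) : Prop :=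
  forall i, (N < i)%N -> m i = 0%N.

Lemma bounded_exists m : exists N, bounded N m.
Proof.
exists (\max_(i <- finsupp m) i)%N => i lti; apply/eqP; rewrite cmE_eq0.
by apply: contraTN lti => im; rewrite -leqNgt; apply: leq_bigmax_seq.
Qed.

Lemma cm_prodE (T : Type) (r : seq T) (P : pred T) (F : T -> {cmonom nat}) i :
  (\big[mmul/mone]_(t <- r | P t) F t) i = (\sum_(t <- r | P t) F t i)%N.
Proof. by apply: (big_morph (fun m : {cmonom nat} => m i)) => [m1 m2|]; rewrite ?cmM ?cm1. Qed.

Lemma prod_var (T : Type) (r : seq T) (P : pred T) (f : T -> nat) :
  \prod_(t <- r | P t) var (f t) = << \big[mmul/mone]_(t <- r | P t) ucm (f t) >> :> series.
Proof.
rewrite (big_morph (fun m : {cmonom nat} => << m >> : series) (id1 := 1) (op1 := *%R)) //.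
by move=> m1 m2; rewrite malgM_def fgmulUU mulr1.
Qed.

Lemma bounded_ucm (T : eqType) N (r : seq T) (f : T -> nat) (t : T) :
  bounded N (\big[mmul/mone]_(t <- r) ucm (f t)) -> t \in r -> (f t <= N)%N.
Proof.
move=> bN tr; rewrite leqNgt; apply/negP => /bN /eqP; rewrite cm_prodE.
by rewrite sum_nat_seq_eq0 => /allP/(_ t tr) /=; rewrite cmUU.
Qed.

(** Only monomials in [x_0, ..., x_N] are compared, so a polynomial [p] can represent an infinite
    series. *)
Definition agree N (f : fps) (p : series) : Prop :=
  forall m, bounded N m -> f m = p@_m.

Lemma agree_one N : agree N fps_one 1.
Proof. by move=> m _; rewrite mcoeff1. Qed.

(** Divisors of a bounded monomial are bounded, so only coefficients on which the factors agree
    occur. *)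
Lemma agree_mul N f g p q : agree N f p -> agree N g q -> agree N (fps_mul f g) (p * q).
Proof.
move=> fp gq m bm; rewrite /fps_mul mcoeffMl.
have bd (a b : {cmonom nat}) : mmul a b = m -> bounded N a /\ bounded N b.
  by move=> abm; split=> i /bm /eqP; rewrite -abm cmM addn_eq0 => /andP[/eqP ? /eqP ?].
(* Pairs outside the supports contribute [0]. *)
pose r := [seq z <- [seq (a, b) | a <- msupp p, b <- msupp q] | mmul z.1 z.2 == m].
rewrite (fsbigE r) /=; first last.
- case=> a b /= abm; have [ba bb] := bd _ _ abm.
  rewrite mem_filter /= abm eqxx /= => /negP nr; rewrite (fp _ ba) (gq _ bb).
  have [ap|] := boolP (a \in msupp p); last by move/mcoeff_outdom ->; rewrite mul0r.
  have [bq|] := boolP (b \in msupp q); last by move/mcoeff_outdom ->; rewrite mulr0.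
  by case: nr; apply/allpairsP; exists (a, b).
- by move=> z /=; rewrite mem_filter => /andP[/eqP].
- rewrite filter_uniq // allpairs_uniq ?fset_uniq //.
  by move=> [a b] [c d] _ _ /= [-> ->].
rewrite big_filter_cond big_mkcond big_allpairs_dep /=; apply: eq_bigr => a _.
apply: eq_bigr => b _; case: eqP => [abm|_] //=.
have [ba bb] := bd _ _ abm.
by rewrite mem_set // (fp _ ba) (gq _ bb).
Qed.

(** A set with an element above [N] has an unbounded monomial; the others are images of subsets of
    ['I_N.+1]. *)
Lemma agree_elementary N k :
  agree N (elementary k) (esp (fun i : 'I_N.+1 => var i) [set: 'I_N.+1] k).
Proof.
move=> m bm; pose F (B : {set 'I_N.+1}) : {fset nat} := [fset val i | i in B]%fset.
have FE B i : (i \in F B) = [exists j in B, i == j :> nat].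
  apply/imfsetP/existsP => /= [[j jB ->]|[j /andP[jB /eqP ->]]]; last by exists j.
  by exists j; rewrite jB eqxx.
have Finj : injective F.
  have sub B C : F B = F C -> B \subset C.
    move=> FBC; apply/fintype.subsetP => i iB.
    have: (i : nat) \in F C by rewrite -FBC FE; apply/existsP; exists i; rewrite iB eqxx.
    by rewrite FE => /existsP[j /andP[jC /eqP/val_inj ->]].
  by move=> B C FBC; apply/eqP; rewrite finset.eqEsubset !sub.
have Fprod B : \big[mmul/mone]_(i <- F B) ucm i = \big[mmul/mone]_(i in B) ucm (i : nat) :> {cmonom nat}.
  rewrite /F big_imfset /=; last by move=> i j _ _; apply: val_inj.
  by rewrite -big_enum; apply: eq_big_seq.
have Fcard B : #|` F B| = #|B|.
  by rewrite card_imfset //=; last exact: val_inj; rewrite -cardE.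
rewrite /elementary /fps_msum (fsbigE [seq F B | B : {set 'I_N.+1} <- enum {: {set 'I_N.+1}} & #|B| == k]) /=; first last.
- move=> S Sk; have [Sm|//] := eqVneq (\big[mmul/mone]_(i <- S) ucm i) m.
  case/negP; rewrite -Sm in bm.
  have SF : S = F [set i : 'I_N.+1 | (i : nat) \in S].
    apply/fsetP => i; rewrite FE; apply/idP/existsP => [iS|[j /andP[]]].
      have iN : (i < N.+1)%N by rewrite ltnS; apply: (bounded_ucm bm).
      by exists (Ordinal iN); rewrite inE iS eqxx.
    by rewrite inE => jS /eqP ->.
  rewrite SF; apply: map_f; rewrite mem_filter mem_enum inE andbT -Fcard -SF.
  exact/eqP.
- by move=> _ /mapP[B + ->] /=; rewrite mem_filter Fcard => /andP[/eqP].
- by rewrite map_inj_uniq // filter_uniq // enum_uniq.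
rewrite big_map big_filter_cond big_enum_cond /esp raddf_sum /=.
apply: eq_big => [B|B _]; last by rewrite prod_var mcoeffU1 Fprod.
rewrite finset.subsetT /=; case: eqP => //= Bk.
by rewrite mem_set //= Fcard.
Qed.

Lemma agree_elementary_part N l :
  agree N (elementary_part l) (esp_prod var N.+1 l).
Proof.
rewrite /elementary_part /esp_prod; elim: l => [|k l IHl].
  by rewrite !big_nil; apply: agree_one.
by rewrite !big_cons; apply: agree_mul => //; apply: agree_elementary.
Qed.

(** Colourings with a colour above [N] have unbounded monomials; the others are words over
    ['I_N.+1]. *)
Lemma agree_chromatic N G : agree N (chromatic_sym G)
  (\sum_(w <- words 'I_N.+1 (nvert G) | proper_word G w) weight (fun i : 'I_N.+1 => var i) w).
Proof.
move=> m bm; pose n := nvert G.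
pose K (w : seq 'I_N.+1) : {ffun 'I_n -> nat} := [ffun i : 'I_n => nth ord0 w i : nat].
have Kinj : {in words 'I_N.+1 n &, injective K}.
  move=> u v; rewrite !mem_words => /eqP su /eqP sv /ffunP Kuv.
  apply: (@eq_from_nth _ ord0) => [|i]; first by rewrite su sv.
  rewrite su => iu; apply: val_inj.
  by have := Kuv (Ordinal iu); rewrite !ffunE.
have Kprod w : size w = n -> \big[mmul/mone]_i ucm (K w i) =
    \big[mmul/mone]_(c <- w) ucm (c : nat) :> {cmonom nat}.
  move=> sw; rewrite (big_nth ord0) sw big_mkord.
  by apply: eq_bigr => i _; rewrite ffunE.
have Kproper w : size w = n -> proper_coloring (K w) <-> proper_word G w.
  move=> sw.
  have nthw (i : 'I_n) : onth w i = Some (nth ord0 w i) by rewrite onthE (nth_map ord0) ?sw.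
  split=> [ok|/forallP ok u v uv].
    apply/forallP => u; apply/forallP => v; apply/implyP => /ok.
    by rewrite !nthw !ffunE => nE; apply/eqP => -[/(congr1 val)].
  have /forallP/(_ v)/implyP/(_ uv) := ok u.
  by rewrite !nthw !ffunE => /eqP nE /val_inj E; apply: nE; rewrite E.
rewrite /chromatic_sym /fps_msum (fsbigE [seq K w | w <- words 'I_N.+1 n & proper_word G w]) /=; first last.
- move=> kappa ok; have [km|//] := eqVneq (\big[mmul/mone]_i ucm (kappa i)) m.
  case/negP; rewrite -km in bm.
  have kN i : (kappa i < N.+1)%N by rewrite ltnS; apply: (bounded_ucm bm); rewrite mem_index_enum.
  pose w := [seq (Ordinal (kN i)) | i <- enum 'I_n].
  have sw : size w = n by rewrite size_map size_enum_ord.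
  have Kw : kappa = K w.
    apply/ffunP => i; rewrite ffunE (nth_map i) ?size_enum_ord //=.
    by rewrite nth_ord_enum.
  rewrite Kw; apply: map_f; rewrite mem_filter mem_words sw eqxx andbT.
  by apply/Kproper => //; rewrite -Kw.
- move=> _ /mapP[w + ->] /=; rewrite mem_filter mem_words => /andP[ok /eqP sw].
  exact/Kproper.
- rewrite map_inj_in_uniq ?filter_uniq ?words_uniq // => u v.
  by rewrite !mem_filter => /andP[_ un] /andP[_ vn]; apply: Kinj.
rewrite big_map big_filter_cond raddf_sum /= big_seq_cond [RHS]big_seq_cond.
apply: eq_big => [w|w /andP[]]; last first.
  by rewrite mem_words => /eqP sw _; rewrite /weight prod_var mcoeffU1 Kprod.
rewrite mem_words; case: eqP => //= sw; apply: andb_idr => ok.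
by apply/mem_set/Kproper.
Qed.

(** * From products of elementary polynomials to partitions *)

Lemma esp_prod_partition (R : comNzRingType) (x : nat -> R) N l :
  esp_prod x N (sort geq (filter (leq 1) l)) = esp_prod x N l.
Proof.
rewrite /esp_prod (perm_big (filter (leq 1) l)) ?perm_sort //= big_filter.
by rewrite big_mkcond; apply: eq_bigr => -[|k] _ //; rewrite esp0.
Qed.

Lemma is_partition_of_sort d l : sumn l = d ->
  is_partition_of d (sort geq (filter (leq 1) l)).
Proof.
move=> ld; split.
- by apply: sort_sorted => a b; apply: leq_total.
- by rewrite all_sort filter_all.
rewrite (perm_sumn (permEl (perm_sort _ _))) -ld.
by elim: l {ld} => [|[|k] l IHl] //=; rewrite IHl.
Qed.

(** The coefficient at a partition is the number of members of [L] that sort to it. It is fixed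
    before [m], while the number of variables depends on [m]: hence the uniformity in [N]. *)
Lemma e_positive_of_esp_pos (G : sgraph) :
  esp_pos var (nvert G) (fun N =>
    \sum_(w <- words 'I_N (nvert G) | proper_word G w) weight (fun i : 'I_N => var i) w) ->
  e_positive G.
Proof.
move=> [L Ld LE]; pose P := [seq sort geq (filter (leq 1) l) | l <- L].
exists (fun l => (count_mem l P)%:Z) => // m.
have [N bm] := bounded_exists m.
rewrite (agree_chromatic _ bm) LE (fsbigE (undup P)) ?undup_uniq //=; first last.
- by move=> l _; rewrite mem_undup => /count_memPn ->; rewrite mul0r.
- by move=> l /=; rewrite mem_undup => /mapP[l' /Ld l'd ->]; apply: is_partition_of_sort.
transitivity (\sum_(l <- P) elementary_part l m).
  rewrite big_map raddf_sum; apply: eq_bigr => l _ /=.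
  by rewrite (agree_elementary_part _ bm) esp_prod_partition.
rewrite -big_undup_iterop_count big_seq_cond [RHS]big_seq_cond.
apply: eq_big => [l|l _]; last first.
  by rewrite -[LHS]/(elementary_part l m *+ count_mem l P) -[LHS]mulr_natl natz.
rewrite mem_undup; case: (boolP (l \in P)) => //= /mapP[l' /Ld l'd ->].
by rewrite mem_set //; apply: is_partition_of_sort.
Qed.

Local Close Scope ring_scope.

Theorem mainTheorem2 (m : nat) (a : m.-tuple nat) :
  1 <= m -> (forall i : 'I_m, 2 <= tnth a i) ->
  e_positive (adjacent_cycle_chain a).
Proof.
move=> m1 a2; apply/e_positive_of_esp_pos/esp_pos_chain.
  by rewrite -size_eq0 size_tuple -lt0n.
by apply/all_tnthP.
Qed.
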